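(* Let $d\ge 3$, $r\ge 1$, $n=dr$, and let $\mathrm{V}\simeq\mathbb{F}^n$ be an $n$-dimensional vector space over $\mathbb{F}$. Consider a generic skew-symmetric tensor of Grassmann rank $r$, $$\mathcal{A}=\sum_{i=1}^r \mathbf{v}_i^1\wedge\dots\wedge\mathbf{v}_i^d\in\wedge^d\mathrm{V}\simeq\wedge^d\mathbb{F}^n,$$ with decomposition factor matrix $V=[V_1\ \cdots\ V_r]\in\mathbb{F}^{n\times n}$, $V_i=[\mathbf{v}_i^1\ \cdots\ \mathbf{v}_i^d]$. Then the kernel of the linear map $\delta_{\mathcal{A}}$ is the following $r(d^2-1)$-dimensional linear subspace of $\mathbb{F}^{n\times n}$: $$\kappa_{\mathcal{A}}:=\ker\delta_{\mathcal{A}}=\{\,V\,\mathrm{diag}(A_1,\dots,A_r)\,V^{-1}\mid A_i\in\mathbb{F}^{d\times d}\text{ with }\mathrm{tr}(A_i)=0\,\}.$$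
   Context: $\mathbb{F}$ is $\mathbb{R}$ or $\mathbb{C}$. The wedge product of $\mathbf{v}_1,\dots,\mathbf{v}_d\in\mathrm{V}$ is $\mathbf{v}_1\wedge\dots\wedge\mathbf{v}_d:=\frac{1}{d!}\sum_{\sigma\in\mathfrak{S}([d])}\mathrm{sign}(\sigma)\,\mathbf{v}_{\sigma(1)}\otimes\dots\otimes\mathbf{v}_{\sigma(d)}\in\mathrm{V}^{\otimes d}$; such tensors are called elementary skew-symmetric tensors, and $\wedge^d\mathrm{V}\subset\mathrm{V}^{\otimes d}$ is their linear span. The Grassmann rank of $\mathcal{A}\in\wedge^d\mathrm{V}$ is the smallest $r$ such that $\mathcal{A}$ is a sum of $r$ elementary skew-symmetric tensors. For a linear map $\dot{A}:\mathrm{V}\to\mathrm{V}$, $\dot{A}\cdot_k\mathcal{A}:=(\mathrm{Id}\otimes\dots\otimes\mathrm{Id}\otimes\dot{A}\otimes\mathrm{Id}\otimes\dots\otimes\mathrm{Id})(\mathcal{A})$ with $\dot{A}$ in position $k$. Define the linear map $\delta_{\mathcal{A}}:\mathrm{End}(\mathrm{V})\simeq\mathbb{F}^{n\times n}\to\wedge^d\mathrm{V}$, $\dot{A}\mapsto\sum_{k=1}^d\dot{A}\cdot_k\mathcal{A}$. $\mathrm{diag}(A_1,\dots,A_r)$ denotes the block diagonal matrix with diagonal blocks $A_i$. A property of elements of an irreducible variety is generic if it fails at most on a strict Zariski closed subset; a ''generic skew-symmetric tensor of Grassmann rank $r$'' is generic in this sense in the Zariski closure $\sigma_r$ of the set of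 sums of $r$ elementary skew-symmetric tensors in $\wedge^d\mathrm{V}$. *)

(* Defs.v *)
From HB Require Import structures.
From mathcomp Require Import all_boot all_order all_fingroup all_algebra.
From mathcomp Require Import reals.
From mathcomp Require Import complex.
From mathcomp Require mpoly.

Set Implicit Arguments.
Unset Strict Implicit.
Unset Printing Implicit Defensive.

Import GRing.Theory.
Local Open Scope ring_scope.

Variant scalar_kind := RealScalars | ComplexScalars.

Definition scalars (R : realType) (b : scalar_kind) : fieldType :=
  match b with
  | RealScalars => R
  | ComplexScalars => complex R
  end.

Section Tensors.

Variables (F : fieldType) (n d : nat).

(* An element of V^{(x)d} for V = F^n, given by its coordinates in the product
   basis e_{f 0} (x) ... (x) e_{f (d-1)}.  The codomain is F^o, the field as a
   vector space over itself, so that [tensor] is canonically a vectType. *)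
Definition tensor := {ffun {ffun 'I_d -> 'I_n} -> F^o}.

Definition tens (v : 'I_d -> 'cV[F]_n) : tensor :=
  [ffun f : {ffun 'I_d -> 'I_n} => \prod_(k < d) v k (f k) 0].

Definition wedge (v : 'I_d -> 'cV[F]_n) : tensor :=
  (d`!%:R)^-1 *: \sum_(s : 'S_d) (-1) ^+ s *: tens (fun k => v (s k)).

Definition skew_tensor (A : tensor) : Prop :=
  exists (m : nat) (c : 'I_m -> F) (v : 'I_m -> 'I_d -> 'cV[F]_n),
    A = \sum_(i < m) c i *: wedge (v i).

Definition wedge_sum (r : nat) (A : tensor) : Prop :=
  exists v : 'I_r -> 'I_d -> 'cV[F]_n, A = \sum_(i < r) wedge (v i).

Definition grassmann_rank (A : tensor) (r : nat) : Prop :=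
  wedge_sum r A /\ forall r' : nat, wedge_sum r' A -> (r <= r')%N.

Definition subst_index (f : {ffun 'I_d -> 'I_n}) (k : 'I_d) (j : 'I_n) :
    {ffun 'I_d -> 'I_n} :=
  [ffun l => if l == k then j else f l].

(* The coordinates of (Id (x) ... (x) X (x) ... (x) Id)(A), X in position k;
   see [mode_mul_tens] below. *)
Definition mode_mul (X : 'M[F]_n) (k : 'I_d) (A : tensor) : tensor :=
  [ffun f : {ffun 'I_d -> 'I_n} =>
     \sum_(j < n) X (f k) j * A (subst_index f k j)].

Lemma mode_mul_tens (X : 'M[F]_n) (k : 'I_d) (v : 'I_d -> 'cV[F]_n) :
  mode_mul X k (tens v) = tens (fun l => if l == k then X *m v k else v l).
Proof.
apply/ffunP => f; rewrite !ffunE (bigD1 k) //= eqxx mxE big_distrl /=.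
apply: eq_bigr => j _; rewrite ffunE (bigD1 k) //= ffunE eqxx -mulrA.
by congr (_ * (_ * _)); apply: eq_bigr => l /negPf lk; rewrite ffunE lk.
Qed.

Lemma mode_mul_is_linear (X : 'M[F]_n) (k : 'I_d) : linear (mode_mul X k).
Proof.
move=> a A B; apply/ffunP => f; rewrite !ffunE scaler_sumr -big_split /=.
apply: eq_bigr => j _; rewrite !ffunE mulrDr; congr (_ + _).
exact: mulrCA.
Qed.

HB.instance Definition _ (X : 'M[F]_n) (k : 'I_d) :=
  GRing.isLinear.Build F tensor tensor *:%R (mode_mul X k)
    (mode_mul_is_linear X k).

(* By [delta_skew] below, this maps into wedge^d V when A is in wedge^d V. *)
Definition delta (A : tensor) (X : 'M[F]_n) : tensor :=
  \sum_(k < d) mode_mul X k A.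

Lemma delta_is_linear (A : tensor) : linear (delta A).
Proof.
move=> a X Y; rewrite /delta scaler_sumr -big_split /=.
apply: eq_bigr => k _; apply/ffunP => f; rewrite !ffunE scaler_sumr.
rewrite -big_split /=; apply: eq_bigr => j _; rewrite !mxE mulrDl.
by congr (_ + _); rewrite -mulrA.
Qed.

HB.instance Definition _ (A : tensor) :=
  GRing.isLinear.Build F 'M[F]_n tensor *:%R (delta A) (delta_is_linear A).

Lemma delta_wedge (v : 'I_d -> 'cV[F]_n) (X : 'M[F]_n) :
  delta (wedge v) X =
  \sum_(k < d) wedge (fun l => if l == k then X *m v k else v l).
Proof.
rewrite /delta /wedge -scaler_sumr.
under eq_bigr do rewrite linearZ /= linear_sum /=.
rewrite -scaler_sumr; congr (_ *: _); rewrite exchange_big /=.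
rewrite [RHS]exchange_big /=; apply: eq_bigr => s _.
rewrite [RHS](reindex_inj (@perm_inj _ s)) /=; apply: eq_bigr => k _.
rewrite linearZ /= mode_mul_tens; congr (_ *: _); apply/ffunP => f.
by rewrite !ffunE; apply: eq_bigr => l _; rewrite (inj_eq perm_inj).
Qed.

Lemma delta_skew (A : tensor) (X : 'M[F]_n) :
  skew_tensor A -> skew_tensor (delta A X).
Proof.
case=> m [c [v ->]].
exists #|{: 'I_m * 'I_d}|, (fun i => c (enum_val i).1),
  (fun i l => if l == (enum_val i).2 then X *m v (enum_val i).1 (enum_val i).2
              else v (enum_val i).1 l).
rewrite -(big_enum_val (fun p : 'I_m * 'I_d => c p.1 *:
  wedge (fun l => if l == p.2 then X *m v p.1 p.2 else v p.1 l))) /=.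
rewrite (eq_bigl xpredT) // -(pair_bigA _ (fun i k => c i *:
  wedge (fun l => if l == k then X *m v i k else v i l))) /=.
rewrite /delta; under [LHS]eq_bigr do rewrite linear_sum.
rewrite exchange_big; apply: eq_bigr => i _ /=.
under eq_bigr do rewrite linearZ /=.
by rewrite -2!(scaler_sumr (c i)) -delta_wedge.
Qed.

Definition delta_ker (A : tensor) : {vspace 'M[F]_n} := lker (linfun (delta A)).

(* Polynomial functions on V^{(x)d}, in its n^d coordinates. *)
Definition tensor_poly := mpoly.mpoly #|{ffun 'I_d -> 'I_n}| F.

Definition poly_at (p : tensor_poly) (A : tensor) : F :=
  mpoly.meval (fun i => A (enum_val i)) p.

Definition zariski_closed (Z : tensor -> Prop) : Prop :=
  exists I : tensor_poly -> Prop,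
    forall A, Z A <-> (forall p, I p -> poly_at p A = 0).

Definition zariski_closure (S : tensor -> Prop) (A : tensor) : Prop :=
  forall Z, zariski_closed Z -> (forall B, S B -> Z B) -> Z A.

Definition sigma (r : nat) (A : tensor) : Prop :=
  skew_tensor A /\ zariski_closure (wedge_sum r) A.

Definition generic_in (X P : tensor -> Prop) : Prop :=
  exists Z : tensor -> Prop,
    [/\ zariski_closed Z,
        forall A, Z A -> X A,
        exists2 A, X A & ~ Z A
      & forall A, X A -> ~ Z A -> P A].

End Tensors.

Lemma sum_blocks (n d r : nat) : n = (d * r)%N -> (\sum_(i < r) d = n)%N.
Proof. by move=> ->; rewrite sum_nat_const card_ord mulnC. Qed.

Section Blocks.

Variables (F : fieldType) (n d r : nat) (hn : n = (d * r)%N).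

(* [\mxrow] and [\mxdiag] produce matrices of size \sum_(i < r) d, which is only
   propositionally equal to n; hence the casts. *)
Definition factor_matrix (V : 'I_r -> 'M[F]_(n, d)) : 'M[F]_n :=
  castmx (erefl n, sum_blocks hn) (\mxrow_(i < r) V i).

Definition block_diag (B : 'I_r -> 'M[F]_d) : 'M[F]_n :=
  castmx (sum_blocks hn, sum_blocks hn) (\mxdiag_(i < r) B i).

End Blocks.

(* Main.v *)
Require Import Defs.
From HB Require Import structures.
From mathcomp Require Import mpoly.
From mathcomp Require Import all_boot all_order all_fingroup all_algebra.
From mathcomp Require Import reals complex.

Set Implicit Arguments.
Unset Strict Implicit.
Unset Printing Implicit Defensive.

Import GRing.Theory.
Local Open Scope ring_scope.

(** Let the columns of V be a basis of F^n, split into r blocks V_i of d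
    vectors, and let W_i be the blocks of rows of V^-1, so that
    W_i V_j = delta_ij and sum_i V_i W_i = 1 ([dual_frame]).  Write
    M_ji = W_j X V_i for the blocks of V^-1 X V.

    By the Leibniz rule, delta_A(X) is the sum, over all blocks i and all
    positions k in them, of the wedge of V_i with its k-th vector v replaced by
    X v.  Expanding X v in the basis, one finds tr(M_ii) times the wedge of V_i
    and, for j <> i, the entries of M_ji times the wedges of V_i with one vector
    replaced by a vector of V_j.  For d >= 3 all these wedges belong to
    different d-element subsets of the basis: at least two vectors of block i
    remain, so that i, the vector taken out and the vector put in can be
    recovered from the subset.  Hence they are linearly independent, and
    delta_A(X) = 0 exactly when every M_ii has trace 0 and every M_ji with
    j <> i vanishes.  Independence is proved by pairing with decomposable
    covectors made of rows of V^-1: the pairing of w_1 (x) ... (x) w_d with a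
    wedge product is a determinant ([pairing_wedge]), and almost all the
    determinants that occur vanish for lack of nonzero entries
    ([delta_eq0_trace], [delta_eq0_offdiag]).  The converse is
    [delta_block_sum].  The dimension follows because the kernel is the
    injective image of the r-tuples of traceless d x d matrices.

    The exceptional closed set consists of the A in sigma_r that some nonzero
    covector w annihilates in every mode ([degenerate]).  It is closed, since
    this says that the maximal minors of a matrix of coordinates of A vanish
    ([degenerate_closed]), and since sigma_r itself is closed
    ([sigma_closed]).  If V is singular, a covector killing its columns
    annihilates A, so that V is invertible off this set
    ([nondegenerate_unit]).  The set is a strict subset: if w annihilates an A
    with V invertible, then u w lies in ker delta_A for every column u, whose
    elements have trace 0, so that w u = 0 for every u
    ([unit_nondegenerate]). *)

(** * Determinants with one column replaced *)
Section ColumnReplacement.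

Variable F : fieldType.

Definition set_col m d (k : 'I_d) (A B : 'M[F]_(m, d)) : 'M[F]_(m, d) :=
  \matrix_(a, b) if b == k then B a b else A a b.

Lemma mul_set_col p m d (k : 'I_d) (U : 'M[F]_(p, m)) (A B : 'M[F]_(m, d)) :
  U *m set_col k A B = set_col k (U *m A) (U *m B).
Proof.
apply/matrixP=> a b; rewrite !mxE; case: ifP => bk;
  by rewrite ?mxE; apply: eq_bigr => j _; rewrite !mxE bk.
Qed.

(** Laplace expansion along column k: the cofactors do not see that column, so
    they are those of the identity. *)
Lemma det_set_col1 d (k : 'I_d) (B : 'M[F]_d) :
  \det (set_col k 1%:M B) = B k k.
Proof.
rewrite (expand_det_col _ k).
have cof a : cofactor (set_col k 1%:M B) a k = (a == k)%:R.
  rewrite -(_ : cofactor 1%:M a k = (a == k)%:R).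
    rewrite /cofactor; congr (_ * \det _); apply/matrixP=> x y.
    by rewrite !mxE [lift _ _ == _]eq_sym (negPf (neq_lift _ _)).
  by have /matrixP/(_ k a) := adj1 F d; rewrite !mxE eq_sym.
rewrite (bigD1 k) //= cof eqxx mulr1 mxE eqxx big1 ?addr0 // => a /negPf ak.
by rewrite cof ak mulr0.
Qed.

Lemma det_set_col_mul d (k : 'I_d) (A B : 'M[F]_d) :
  \det (set_col k A (A *m B)) = \det A * B k k.
Proof. by rewrite -{1}(mulmx1 A) -mul_set_col det_mulmx det_set_col1. Qed.

(** In each term of the Leibniz formula, at most one of the rows a1 and a2 is
    evaluated in column c; the other one contributes a zero. *)
Lemma det_rows_in_line d (A : 'M[F]_d) (a1 a2 c : 'I_d) :
  a1 != a2 -> (forall b, b != c -> A a1 b = 0) ->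
  (forall b, b != c -> A a2 b = 0) -> \det A = 0.
Proof.
move=> a12 A1 A2; rewrite /determinant big1 // => s _.
have [sa1|sa1] := eqVneq (s a1) c; last first.
  by rewrite (bigD1 a1) //= A1 // mul0r mulr0.
rewrite (bigD1 a2) //= A2 ?mul0r ?mulr0 //.
by rewrite -sa1 (inj_eq perm_inj) eq_sym.
Qed.

End ColumnReplacement.

(** * Pairing with decomposable covectors *)
Section Pairing.

Variables (F : fieldType) (n d : nat).
Implicit Types (v : 'I_d -> 'cV[F]_n) (A : tensor F n d).

Lemma eq_wedge v v' : v =1 v' -> wedge v = wedge v'.
Proof.
move=> vv'; congr (_ *: _); apply: eq_bigr => s _; congr (_ *: _).
by apply/ffunP=> f; rewrite !ffunE; apply: eq_bigr => k _; rewrite vv'.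
Qed.

Lemma wedgeE v (f : {ffun 'I_d -> 'I_n}) :
  wedge v f = (d`!%:R)^-1 * \det (\matrix_(a, b) v b (f a) 0).
Proof.
rewrite /wedge ffunE; congr (_ * _); rewrite sum_ffunE; apply: eq_bigr => s _.
by rewrite !ffunE; congr (_ * _); apply: eq_bigr => k _; rewrite mxE.
Qed.

(** The value on A of u_1 (x) ... (x) u_d, where u_k is row k of U. *)
Definition pairing (U : 'M[F]_(d, n)) (A : tensor F n d) : F :=
  \sum_(f : {ffun 'I_d -> 'I_n}) (\prod_(k < d) U k (f k)) * A f.

Lemma pairing0 U : pairing U 0 = 0.
Proof. by rewrite /pairing big1 // => f _; rewrite ffunE mulr0. Qed.

Lemma pairingZ U c A : pairing U (c *: A) = c * pairing U A.
Proof.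
by rewrite /pairing mulr_sumr; apply: eq_bigr => f _; rewrite ffunE mulrCA.
Qed.

Lemma pairing_sum U (I : finType) (A : I -> tensor F n d) :
  pairing U (\sum_i A i) = \sum_i pairing U (A i).
Proof.
rewrite /pairing exchange_big; apply: eq_bigr => f _.
by rewrite sum_ffunE mulr_sumr.
Qed.

(** On a decomposable tensor the pairing is a product of values u_k(v_l), so the
    alternating sum in the wedge product is a Leibniz formula. *)
Lemma pairing_wedge U v :
  pairing U (wedge v) = (d`!%:R)^-1 * \det (U *m \matrix_(j, k) v k j 0).
Proof.
rewrite /wedge pairingZ pairing_sum; congr (_ * _); apply: eq_bigr => s _.
rewrite pairingZ; congr (_ * _).
rewrite (eq_bigr (fun k => \sum_j U k j * v (s k) j 0)); last first.
  by move=> k _; rewrite mxE; apply: eq_bigr => j _; rewrite mxE.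
rewrite bigA_distr_bigA; apply: eq_bigr => f _.
by rewrite /tens ffunE -big_split.
Qed.

End Pairing.

(** * The kernel of delta for a basis split into blocks *)
Section Kernel.

Variables (F : fieldType) (n d r : nat).
Implicit Types (V : 'I_r -> 'M[F]_(n, d)) (X : 'M[F]_n).

(** Leibniz rule: X acts on one vector of one block at a time. *)
Lemma delta_sum_wedge V X :
  delta (\sum_(i < r) wedge (fun k => col k (V i))) X =
  \sum_(i < r) \sum_(k < d)
     wedge (fun l => col l (set_col k (V i) (X *m V i))).
Proof.
rewrite /delta; under eq_bigr do rewrite linear_sum.
rewrite exchange_big; apply: eq_bigr => i _ /=.
rewrite -/(delta _ _) delta_wedge; apply: eq_bigr => k _.
apply: eq_wedge => l; apply/matrixP=> a b; rewrite !mxE.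
case: eqP => [->|_]; rewrite ?mxE //.
by apply: eq_bigr => j _; rewrite !mxE.
Qed.

Lemma pairing_delta V X (U : 'M[F]_(d, n)) :
  pairing U (delta (\sum_(i < r) wedge (fun k => col k (V i))) X) =
  (d`!%:R)^-1 * \sum_(i < r) \sum_(k < d)
     \det (set_col k (U *m V i) (U *m X *m V i)).
Proof.
rewrite delta_sum_wedge pairing_sum mulr_sumr; apply: eq_bigr => i _.
rewrite pairing_sum mulr_sumr; apply: eq_bigr => k _.
rewrite pairing_wedge; congr (_ * \det _); rewrite -mulmxA -mul_set_col.
by congr (_ *m _); apply/matrixP=> a b; rewrite !mxE.
Qed.

Variables (V : 'I_r -> 'M[F]_(n, d)) (W : 'I_r -> 'M[F]_(d, n)).
Hypothesis WV : forall i j, W i *m V j = if i == j then 1%:M else 0.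
Hypothesis VW : \sum_(i < r) V i *m W i = 1%:M.
Hypothesis d_ge3 : (3 <= d)%N.
Hypothesis char0 : [pchar F] =i pred0.

Let A := \sum_(i < r) wedge (fun k => col k (V i)).

Lemma inv_fact_neq0 : ((d`!%:R)^-1 : F) != 0.
Proof. by rewrite invr_eq0 (proj1 (pcharf0P F) char0) -lt0n fact_gt0. Qed.

(** This is where d >= 3 enters: after one vector of a block is exchanged, two
    others remain. *)
Lemma two_others (k : 'I_d) :
  exists a1 a2 : 'I_d, [/\ a1 != a2, a1 != k & a2 != k].
Proof.
have [a1 a1k] : exists a1, a1 \in [set~ k].
  by apply/card_gt0P; rewrite cardsC1 card_ord -subn1 subn_gt0 ltnW.
have [a2] : exists a2, a2 \in [set~ k] :\ a1.
  apply/card_gt0P; have := cardsD1 a1 [set~ k].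
  rewrite a1k cardsC1 card_ord add1n => dE.
  by rewrite -ltnS -dE -subn1 ltn_subRL.
move: a1k; rewrite !inE => a1k /andP[a21 a2k].
by exists a1, a2; rewrite eq_sym.
Qed.

(** Two rows of M other than k are zero, and in the modified matrix they are
    supported in the replaced column. *)
Lemma det_set_col_single_row (k l : 'I_d) (M N : 'M[F]_d) :
  (forall a b, a != k -> M a b = 0) -> \det (set_col l M N) = 0.
Proof.
move=> M0; have [a1 [a2 [a12 a1k a2k]]] := two_others k.
apply: (det_rows_in_line (c := l) a12) => b /negPf bl; rewrite mxE bl;
  exact: M0.
Qed.

(** The rows of W_i pair to zero with the contribution of every other block, and
    pick the diagonal of M_ii from that of block i. *)
Lemma delta_eq0_trace X : delta A X = 0 ->
  forall i, \tr (W i *m X *m V i) = 0.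
Proof.
move=> AX0 i; have := pairing_delta V X (W i).
rewrite AX0 pairing0 => /esym/eqP.
rewrite mulf_eq0 (negPf inv_fact_neq0) /= (bigD1 i) //=.
rewrite [X in _ + X]big1 ?addr0 => [/eqP trE|j ji].
  rewrite -[RHS]trE /mxtrace; apply: eq_bigr => k _.
  by rewrite WV eqxx det_set_col1.
rewrite big1 // => k _; apply: (@det_set_col_single_row k) => a b _.
by rewrite WV eq_sym (negPf ji) mxE.
Qed.

(** The covector that isolates the entry (l, k) of M_ji is dual to block i with
    its k-th vector exchanged for the l-th vector of block j. *)
Lemma delta_eq0_offdiag X : delta A X = 0 ->
  forall i j, i != j -> W j *m X *m V i = 0.
Proof.
move=> AX0 i j ij; apply/matrixP=> l k; rewrite [RHS]mxE.
pose U : 'M[F]_(d, n) := \matrix_(a, b) if a == k then W j l b else W i a b.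
have Urow p (Y : 'M[F]_(n, p)) a b :
    (U *m Y) a b = if a == k then (W j *m Y) l b else (W i *m Y) a b.
  rewrite !mxE; case: ifP => ak; rewrite ?mxE; apply: eq_bigr => c _;
    by rewrite mxE ak.
have := pairing_delta V X U; rewrite AX0 pairing0 => /esym/eqP.
rewrite mulf_eq0 (negPf inv_fact_neq0) /= (bigD1 i) //=.
rewrite [X in _ + X]big1 => [|i' ii'].
  rewrite addr0 (bigD1 k) //= [X in _ + X]big1 => [|k' kk'].
    rewrite addr0 => /eqP.
    have -> : set_col k (U *m V i) (U *m X *m V i) =
              set_col k 1%:M (U *m X *m V i).
      apply/matrixP=> a b; rewrite [LHS]mxE [RHS]mxE; case: ifPn => // bk.
      rewrite Urow !WV eqxx [j == i]eq_sym (negPf ij).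
      by case: eqP => [->|//]; rewrite !mxE eq_sym (negPf bk).
    by rewrite det_set_col1 -!mulmxA Urow eqxx.
  (* A vector other than the k-th is replaced, and the k-th column stays 0. *)
  rewrite (expand_det_col _ k) big1 // => a _.
  rewrite mxE eq_sym (negPf kk') Urow !WV eqxx [j == i]eq_sym (negPf ij).
  by case: eqP => [|/eqP/negPf]; rewrite !mxE ?mul0r // => ->; rewrite mul0r.
(* In a block i' <> i only row k, the one taken from W_j, can be nonzero. *)
rewrite big1 // => k' _; apply: (@det_set_col_single_row k) => a b ak.
by rewrite Urow (negPf ak) WV eq_sym (negPf ii') mxE.
Qed.

(** X = sum_i V_i B_i W_i sends V_i to V_i B_i, so that replacing the k-th
    vector of V_i multiplies its wedge by the diagonal entry k of B_i; these
    add up to the trace. *)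
Lemma delta_block_sum (B : 'I_r -> 'M[F]_d) :
  (forall i, \tr (B i) = 0) ->
  delta A (\sum_(i < r) V i *m B i *m W i) = 0.
Proof.
move=> trB; rewrite delta_sum_wedge big1 // => i _; apply/ffunP=> f.
rewrite sum_ffunE [RHS]ffunE.
have -> : (\sum_(j < r) V j *m B j *m W j) *m V i = V i *m B i.
  rewrite mulmx_suml (bigD1 i) //= big1 ?addr0 => [|j /negPf ji].
    by rewrite -mulmxA WV eqxx mulmx1.
  by rewrite -mulmxA WV ji mulmx0.
transitivity (\sum_(k < d)
    (d`!%:R)^-1 * (\det (rowsub f (V i)) * B i k k)).
  apply: eq_bigr => k _; rewrite wedgeE -det_set_col_mul; congr (_ * \det _).
  apply/matrixP=> a b; rewrite !mxE; case: ifP => // _.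
  by apply: eq_bigr => c _; rewrite mxE.
by rewrite -!mulr_sumr -/(mxtrace (B i)) trB !mulr0.
Qed.

Lemma delta_eq0P X : delta A X = 0 <->
  exists B : 'I_r -> 'M[F]_d,
    (forall i, \tr (B i) = 0) /\ X = \sum_(i < r) V i *m B i *m W i.
Proof.
split=> [AX0|[B [trB ->]]]; last exact: delta_block_sum.
exists (fun i => W i *m X *m V i); split; first exact: delta_eq0_trace.
transitivity (\sum_i \sum_j V i *m W i *m X *m (V j *m W j)).
  under eq_bigr do rewrite -mulmx_sumr VW mulmx1.
  by rewrite -mulmx_suml VW mul1mx.
apply: eq_bigr => i _; rewrite (bigD1 i) //= big1 ?addr0 ?mulmxA // => j ji.
rewrite -!mulmxA ![in X in V i *m X]mulmxA.
by rewrite delta_eq0_offdiag // mul0mx mulmx0.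
Qed.

End Kernel.

(** * The space of traceless block sums *)
Section Dimension.

Variables (F : fieldType) (d r : nat).
Hypothesis d_gt0 : (0 < d)%N.

Definition block_traces (B : {ffun 'I_r -> 'M[F]_d}) : {ffun 'I_r -> F^o} :=
  [ffun i => \tr (B i)].

Lemma block_traces_is_linear : linear block_traces.
Proof.
by move=> a B C; apply/ffunP=> i; rewrite !ffunE linearD linearZ.
Qed.

HB.instance Definition _ :=
  GRing.isLinear.Build F _ _ *:%R block_traces block_traces_is_linear.

Lemma dim_lker_block_traces :
  \dim (lker (linfun block_traces)) = (r * (d ^ 2 - 1))%N.
Proof.
have := limg_ker_dim (linfun block_traces) fullv.
have -> : (linfun block_traces @: fullv)%VS = fullv.
  apply/eqP; rewrite eqEsubv subvf /=; apply/subvP=> t _; apply/memv_imgP.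
  pose k : 'I_d := Ordinal d_gt0.
  exists [ffun i => t i *: delta_mx k k]; rewrite ?memvf // lfunE /=.
  apply/ffunP=> i; rewrite !ffunE mxtraceZ /mxtrace (bigD1 k) //= big1.
    by rewrite mxE !eqxx addr0 mulr1.
  by move=> j /negPf jk; rewrite mxE jk.
rewrite capfv !dimvf => dimE.
apply/eqP; rewrite mulnBr muln1 -(eqn_add2r r) subnK; last first.
  by rewrite leq_pmulr // expn_gt0 d_gt0.
have dim_ffun (vT : vectType F) : dim {ffun 'I_r -> vT} = (r * dim vT)%N.
  by rewrite -[LHS]/(#|'I_r| * dim vT)%N card_ord.
by apply/eqP; move: dimE; rewrite !dim_ffun dim_matrix -[dim F^o]/1%N muln1.
Qed.

Variables (n : nat) (V : 'I_r -> 'M[F]_(n, d)) (W : 'I_r -> 'M[F]_(d, n)).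

Definition block_sum (B : {ffun 'I_r -> 'M[F]_d}) : 'M[F]_n :=
  \sum_(i < r) V i *m B i *m W i.

Lemma block_sum_is_linear : linear block_sum.
Proof.
move=> a B C; rewrite /block_sum scaler_sumr -big_split /=.
apply: eq_bigr => i _.
by rewrite !ffunE mulmxDr mulmxDl -scalemxAr -scalemxAl.
Qed.

HB.instance Definition _ :=
  GRing.isLinear.Build F _ _ *:%R block_sum block_sum_is_linear.

Hypothesis WV : forall i j, W i *m V j = if i == j then 1%:M else 0.

Lemma block_sumK (B : {ffun 'I_r -> 'M[F]_d}) i :
  W i *m block_sum B *m V i = B i.
Proof.
rewrite /block_sum mulmx_sumr mulmx_suml (bigD1 i) //= big1 => [|j /negPf ji].
  by rewrite addr0 -!mulmxA WV eqxx mulmx1 mulmxA WV eqxx mul1mx.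
by rewrite -!mulmxA WV ji !mulmx0.
Qed.

Lemma dim_traceless_block_sums :
  \dim (linfun block_sum @: lker (linfun block_traces))%VS =
  (r * (d ^ 2 - 1))%N.
Proof.
rewrite limg_dim_eq ?dim_lker_block_traces //.
suff /eqP-> : lker (linfun block_sum) == 0%VS by rewrite capv0.
apply/lker0P=> B C; rewrite !lfunE /= => BC.
by apply/ffunP=> i; rewrite -[LHS]block_sumK BC block_sumK.
Qed.

End Dimension.

(** * Factor matrices and dual frames *)
Section Frames.

Variables (F : fieldType) (n d r : nat) (hn : n = (d * r)%N).
Implicit Types V : 'I_r -> 'M[F]_(n, d).

(** The W_i are the blocks of rows of the inverse of the factor matrix. *)
Lemma dual_frame V : factor_matrix hn V \in unitmx ->
  exists W : 'I_r -> 'M[F]_(d, n),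
    [/\ forall i j, W i *m V j = if i == j then 1%:M else 0,
        \sum_(i < r) V i *m W i = 1%:M
      & forall B, factor_matrix hn V *m block_diag hn B
                    *m invmx (factor_matrix hn V) =
                  \sum_(i < r) V i *m B i *m W i].
Proof.
rewrite /factor_matrix /block_diag; move: (sum_blocks hn) => e.
clear hn; case: n / e V => V; rewrite !castmx_id => Vu.
exists (submxcol (invmx (\mxrow_i V i))).
have VE := submxcolK (invmx (\mxrow_i V i)).
split=> [i j||B].
- have := mulVmx Vu; rewrite -[X in X *m _]VE mul_mxcol_mxrow -mxdiagZ.
  rewrite /mxdiag => /eq_mxblockP/(_ i j) ->.
  by case: (i == j); rewrite ?conform_mx_id.
- by rewrite -mul_mxrow_mxcol VE mulmxV.
- by rewrite castmx_id -[X in _ *m X]VE mul_mxrow_mxdiag mul_mxrow_mxcol.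
Qed.

Lemma mul_factor_matrix_eq0 V (w : 'rV[F]_n) :
  w *m factor_matrix hn V = 0 -> forall i, w *m V i = 0.
Proof.
rewrite /factor_matrix; move: (sum_blocks hn) => e.
clear hn; case: n / e V w => V w; rewrite castmx_id mul_mxrow.
by rewrite -mxrow0 => /eq_mxrowP.
Qed.

Lemma factor_matrix_onto (P : 'M[F]_n) : exists V, factor_matrix hn V = P.
Proof.
rewrite /factor_matrix; move: (sum_blocks hn) => e.
clear hn; case: n / e P => P.
by exists (submxrow P); rewrite castmx_id submxrowK.
Qed.

End Frames.

(** * Zariski closed sets of tensors *)
Section Zariski.

Variables (F : fieldType) (n d : nat).
Implicit Types (Z S : tensor F n d -> Prop) (A : tensor F n d).

Definition coord (f : {ffun 'I_d -> 'I_n}) : tensor_poly F n d :=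
  @mpolyX _ F (mnm1 (enum_rank f)).

Lemma poly_at_coord f A : poly_at (coord f) A = A f.
Proof. by rewrite /poly_at mevalXU enum_rankK. Qed.

Lemma zariski_closed_and Z1 Z2 : zariski_closed Z1 -> zariski_closed Z2 ->
  zariski_closed (fun A => Z1 A /\ Z2 A).
Proof.
move=> [I1 H1] [I2 H2]; exists (fun p => I1 p \/ I2 p) => A.
rewrite H1 H2; split=> [[A1 A2] p []|A12]; [exact: A1|exact: A2|].
by split=> p Ip; apply: A12; [left|right].
Qed.

Lemma zariski_closed_family (T : Type) (p : T -> tensor_poly F n d) Z :
  (forall A, Z A <-> forall t, poly_at (p t) A = 0) -> zariski_closed Z.
Proof.
move=> ZE; exists (fun q => exists t, q = p t) => A; rewrite ZE.
by split=> [pA _ [t ->]|pA t]; [exact: pA|apply: pA; exists t].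
Qed.

(** The closure of S is the zero set of all the polynomials vanishing on S. *)
Lemma zariski_closure_closed S : zariski_closed (zariski_closure S).
Proof.
exists (fun p => forall B, S B -> poly_at p B = 0) => A; split=> [clA p pS|pA].
  apply: (clA (fun B => poly_at p B = 0)) => //.
  by exists (fun q => q = p) => B; split=> [pB _ -> //|]; apply.
move=> Z [I ZE] SZ; apply/ZE => p Ip; apply: pA => B /SZ/ZE; exact.
Qed.

Hypothesis char0 : [pchar F] =i pred0.

Lemma tensorZ c A f : (c *: A) f = c * A f :> F.
Proof. by rewrite ffunE. Qed.

(** In characteristic 0 a tensor with this symmetry equals its average over the
    symmetric group, and the average of e_(f 1) (x) ... (x) e_(f d) is a wedge
    product of basis vectors. *)
Lemma skew_tensorP A : skew_tensor A <->
  forall (f : {ffun 'I_d -> 'I_n}) (s : 'S_d),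
    A [ffun k => f (s k)] = (-1) ^+ s * A f :> F.
Proof.
split=> [[m [c [v ->]]] f s|skA].
  rewrite !sum_ffunE mulr_sumr; apply: eq_bigr => i _.
  rewrite !(tensorZ (c i)) !wedgeE [RHS]mulrCA; congr (_ * _).
  rewrite [RHS]mulrCA; congr (_ * _).
  rewrite -det_perm -det_mulmx -row_permE; congr (\det _).
  by apply/matrixP=> a b; rewrite !mxE ffunE.
pose e (f : {ffun 'I_d -> 'I_n}) k : 'cV[F]_n := delta_mx (f k) 0.
exists #|{ffun 'I_d -> 'I_n}|, (fun i => A (enum_val i)),
  (fun i => e (enum_val i)).
rewrite -(big_enum_val (fun f => A f *: wedge (e f))) /=.
rewrite (eq_bigl xpredT) //; apply/ffunP=> g; rewrite sum_ffunE.
transitivity ((d`!%:R)^-1 * \sum_(s : 'S_d) A g).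
  rewrite sumr_const card_Sn -[X in _ * X]mulr_natl mulKf //.
  by rewrite (proj1 (pcharf0P F) char0) -lt0n fact_gt0.
under [RHS]eq_bigr => f _.
  rewrite (tensorZ (A f)) wedgeE mulrCA mulr_sumr; over.
rewrite -mulr_sumr exchange_big; congr (_ * _); apply: eq_bigr => s _ /=.
(* Only the term f = g o s^-1 of the sum over f survives. *)
pose gs := [ffun k => g ((s^-1)%g k)].
rewrite (bigD1 gs) //= [X in _ + X]big1 ?addr0 => [|f fgs].
  rewrite big1 => [|k _]; last by rewrite !mxE /gs ffunE permK !eqxx.
  have := skA g (s^-1)%g; rewrite odd_permV -/gs => ->.
  by rewrite mulr1 mulrAC -expr2 sqrr_sign mul1r.
suff [k kP] : exists k, f (s k) != g k.
  by rewrite (bigD1 k) //= !mxE eq_sym (negPf kP) mul0r !mulr0.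
apply/existsP; apply: contraR fgs; rewrite negb_exists => /forallP fg.
apply/eqP/ffunP=> k; rewrite ffunE.
by have := fg ((s^-1)%g k); rewrite negbK permKV => /eqP.
Qed.

Lemma skew_tensor_closed : zariski_closed (@skew_tensor F n d).
Proof.
pose p (t : {ffun 'I_d -> 'I_n} * 'S_d) : tensor_poly F n d :=
  coord [ffun k => t.1 (t.2 k)] - mpolyC _ ((-1) ^+ t.2) * coord t.1.
apply: (zariski_closed_family (p := p)) => A.
have poly_atE f s : poly_at (p (f, s)) A =
    A [ffun k => f (s k)] - (-1) ^+ s * A f.
  rewrite /poly_at mevalB mevalM mevalC.
  by rewrite -!/(poly_at _ _) !poly_at_coord.
rewrite skew_tensorP; split=> [skA [f s]|skA f s].
  by rewrite poly_atE skA subrr.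
by apply/eqP; rewrite -subr_eq0 -poly_atE (skA (f, s)).
Qed.

Lemma sigma_closed r : zariski_closed (@sigma F n d r).
Proof.
apply: zariski_closed_and; [exact: skew_tensor_closed|].
exact: zariski_closure_closed.
Qed.

Lemma wedge_sum_sigma r A : wedge_sum r A -> sigma r A.
Proof.
move=> wA; split; last by move=> Z _; apply.
case: wA => v ->; exists r, (fun=> 1), v.
by apply: eq_bigr => i _; rewrite scale1r.
Qed.

End Zariski.

(** * Tensors annihilated by a covector in every mode *)
Section Degenerate.

Variables (F : fieldType) (n d : nat).
Implicit Types A : tensor F n d.

Definition contracted_by (w : 'rV[F]_n) A : Prop :=
  forall (k : 'I_d) (f : {ffun 'I_d -> 'I_n}),
    \sum_(j < n) w 0 j * A (subst_index f k j) = 0.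

Definition degenerate A : Prop := exists2 w, w != 0 & contracted_by w A.

(** The rank-one endomorphism u w acts on a mode by contracting it with w and
    inserting u instead. *)
Lemma contracted_byP w A :
  contracted_by w A <->
  forall (u : 'cV[F]_n) (k : 'I_d), mode_mul (u *m w) k A = 0.
Proof.
split=> [wA u k|wA k f].
  apply/ffunP=> f; rewrite !ffunE.
  transitivity (u (f k) 0 * \sum_(j < n) w 0 j * A (subst_index f k j)).
    by rewrite mulr_sumr; apply: eq_bigr => j _; rewrite mxE big_ord1 mulrA.
  by rewrite wA mulr0.
have /ffunP/(_ f) := wA (const_mx 1) k; rewrite !ffunE => wAf.
rewrite -[RHS]wAf.
by apply: eq_bigr => j _; rewrite mxE big_ord1 mxE mul1r.
Qed.

Lemma contracted_by_wedge_sum r (v : 'I_r -> 'I_d -> 'cV[F]_n) (w : 'rV[F]_n) :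
  (forall i k, w *m v i k = 0) -> contracted_by w (\sum_(i < r) wedge (v i)).
Proof.
move=> wv; apply/contracted_byP=> u k; rewrite linear_sum big1 // => i _.
rewrite /wedge linearZ linear_sum big1 => [|s _]; first exact: scaler0.
rewrite linearZ /= mode_mul_tens -mulmxA wv mulmx0.
suff -> : tens (fun l => if l == k then 0 else v i (s l)) = 0.
  by rewrite scaler0.
by apply/ffunP=> f; rewrite !ffunE (bigD1 k) //= eqxx mxE mul0r.
Qed.

Lemma delta_contracted_by w A u : contracted_by w A -> delta A (u *m w) = 0.
Proof. by move=> /contracted_byP wA; rewrite /delta big1. Qed.

(** A matrix with independent rows has an invertible maximal square
    submatrix. *)
Lemma left_kernel_minors p (M : 'M[F]_(n, p)) :
  (exists2 w : 'rV_n, w != 0 & w *m M = 0) <->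
  forall g : 'I_n -> 'I_p, \det (colsub g M) = 0.
Proof.
split=> [[w w0 wM] g|minors0].
  apply/eqP/det0P; exists w => //; apply/rowP=> l.
  have /rowP/(_ (g l)) := wM; rewrite !mxE => wMl; rewrite -[RHS]wMl.
  by apply: eq_bigr => j _; rewrite mxE.
have [Mfree|] := boolP (row_free M); last first.
  rewrite -kermx_eq0 => /rowV0Pn[w /sub_kermxP wM w0]; by exists w.
have Mfull : row_full M^T by rewrite /row_full mxrank_tr.
have := fullrowsub_unit Mfull; rewrite unitmxE unitfE -det_tr.
suff -> : (rowsub (fullrankfun Mfull) M^T)^T = colsub (fullrankfun Mfull) M.
  by rewrite minors0 eqxx.
by apply/matrixP=> a b; rewrite !mxE.
Qed.

(** The contractions of A with w, for all modes k and all indices f of the other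
    modes, are the entries of w *m M for a matrix M of coordinates of A. *)
Lemma degenerate_closed : zariski_closed degenerate.
Proof.
pose K : finType := ('I_d * {ffun 'I_d -> 'I_n})%type.
pose idx (c : 'I_#|K|) j := subst_index (enum_val c).2 (enum_val c).1 j.
pose p (g : 'I_n -> 'I_#|K|) : tensor_poly F n d :=
  \det (\matrix_(j, l) (coord F (idx (g l) j) : mpoly _ F)).
apply: (zariski_closed_family (p := p)) => A.
pose M : 'M[F]_(n, #|K|) := \matrix_(j, c) A (idx c j).
have contractedE w : contracted_by w A <-> w *m M = 0.
  split=> [wA|/rowP wM k f].
    apply/rowP=> c; rewrite !mxE -[RHS](wA (enum_val c).1 (enum_val c).2).
    by apply: eq_bigr => j _; rewrite mxE.
  have := wM (enum_rank (k, f)); rewrite !mxE => wMc; rewrite -[RHS]wMc.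
  by apply: eq_bigr => j _; rewrite mxE /idx enum_rankK.
have pE g : poly_at (p g) A = \det (colsub g M).
  rewrite /poly_at /p -det_map_mx; congr (\det _).
  apply/matrixP=> j l; rewrite !mxE; exact: poly_at_coord.
split=> [[w w0 /contractedE wM] g|pA].
  by rewrite pE; apply: (proj1 (left_kernel_minors M)); exists w.
have [|w w0 /contractedE wA] := proj2 (left_kernel_minors M); last by exists w.
by move=> g; rewrite -pE.
Qed.

End Degenerate.

(** * Degeneracy and the factor matrix *)
Section Degeneracy.

Variables (F : fieldType) (n d r : nat) (hn : n = (d * r)%N).
Hypothesis d_ge3 : (3 <= d)%N.
Hypothesis char0 : [pchar F] =i pred0.

(** A covector killing all the vectors of V contracts every wedge to 0. *)
Lemma nondegenerate_unit (V : 'I_r -> 'M[F]_(n, d)) :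
  ~ degenerate (\sum_(i < r) wedge (fun k => col k (V i))) ->
  factor_matrix hn V \in unitmx.
Proof.
move=> ndeg; rewrite unitmxE unitfE; apply/negP=> /det0P[w w0 wV].
apply: ndeg; exists w => //; apply: contracted_by_wedge_sum => i k.
by rewrite colE mulmxA (mul_factor_matrix_eq0 wV) mul0mx.
Qed.

Lemma delta_ker_block_sums (V : 'I_r -> 'M[F]_(n, d)) W :
  (forall i j, W i *m V j = if i == j then 1%:M else 0) ->
  \sum_(i < r) V i *m W i = 1%:M ->
  delta_ker (\sum_(i < r) wedge (fun k => col k (V i))) =
  (linfun (block_sum V W) @: lker (linfun (@block_traces F d r)))%VS.
Proof.
move=> WV VW; apply/vspaceP=> X; rewrite memv_ker lfunE /=.
apply/eqP/memv_imgP=> [|[B]].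
  move/(delta_eq0P WV VW d_ge3 char0)=> [B [trB ->]].
  exists [ffun i => B i]; last first.
    by rewrite lfunE /= /block_sum; apply: eq_bigr => i _; rewrite ffunE.
  by rewrite memv_ker lfunE; apply/eqP/ffunP=> i; rewrite !ffunE trB.
rewrite memv_ker lfunE /= => /eqP/ffunP trB ->; rewrite lfunE /=.
by apply: delta_block_sum => // i; have := trB i; rewrite !ffunE.
Qed.

(** If w contracts A to 0, then u w lies in the kernel of delta for each column
    u; its diagonal blocks have trace 0, whence tr (u w) = w u = 0. *)
Lemma unit_nondegenerate (V : 'I_r -> 'M[F]_(n, d)) :
  factor_matrix hn V \in unitmx ->
  ~ degenerate (\sum_(i < r) wedge (fun k => col k (V i))).
Proof.
move=> /dual_frame[W [WV VW _]] [w /eqP w0 wA]; apply: w0; apply/rowP=> j.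
rewrite mxE.
have /(delta_eq0_trace WV d_ge3 char0) tr0 :=
  delta_contracted_by (delta_mx j 0) wA.
have : \tr (delta_mx j 0 *m w) = 0.
  rewrite -[_ *m w]mulmx1 -VW mulmx_sumr raddf_sum /= big1 // => i _.
  by rewrite mulmxA mxtrace_mulC mulmxA tr0.
by rewrite mxtrace_mulC -colE trace_mx11 mxE.
Qed.

End Degeneracy.

Lemma scalars_char0 (R : realType) (b : scalar_kind) :
  [pchar (scalars R b)] =i pred0.
Proof. by case: b; exact: Num.Theory.pchar_num. Qed.

Theorem theorem4p7 (R : realType) (b : scalar_kind) (d r n : nat)
    (hd : (3 <= d)%N) (hr : (1 <= r)%N) (hn : n = (d * r)%N) :
  generic_in (@sigma (scalars R b) n d r)
    (fun A : tensor (scalars R b) n d =>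
       grassmann_rank A r ->
       forall V : 'I_r -> 'M[scalars R b]_(n, d),
         A = \sum_(i < r) wedge (fun k => col k (V i)) ->
         [/\ factor_matrix hn V \in unitmx,
             \dim (delta_ker A) = (r * (d ^ 2 - 1))%N
           & forall X : 'M[scalars R b]_n,
               X \in delta_ker A <->
               exists B : 'I_r -> 'M[scalars R b]_d,
                 (forall i, \tr (B i) = 0) /\
                 X = factor_matrix hn V *m block_diag hn B
                       *m invmx (factor_matrix hn V)]).
Proof.
have char0 := scalars_char0 R b.
exists (fun A => sigma r A /\ degenerate A); split.
- apply: zariski_closed_and; last exact: degenerate_closed.
  exact: sigma_closed.
- by move=> A [].
- have [V V1] := factor_matrix_onto hn (1%:M : 'M[scalars R b]_n).
  exists (\sum_(i < r) wedge (fun k => col k (V i))).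
    by apply: wedge_sum_sigma; exists (fun i k => col k (V i)).
  by case=> _; apply: (unit_nondegenerate (hn := hn)) => //; rewrite V1 unitmx1.
move=> A sA ndeg _ V AV.
have {ndeg}Vu : factor_matrix hn V \in unitmx.
  by apply: nondegenerate_unit; rewrite -AV => degA; apply: ndeg.
have [W [WV VW conj]] := dual_frame Vu.
split=> // [|X]; subst A.
  rewrite (delta_ker_block_sums hd char0 WV VW) dim_traceless_block_sums //.
  exact: ltn_trans hd.
rewrite memv_ker lfunE /=; split.
  move/eqP/(delta_eq0P WV VW hd char0)=> [B [trB ->]].
  by exists B; rewrite conj.
case=> B [trB ->]; apply/eqP; rewrite conj; exact: delta_block_sum.
Qed.
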